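(* Let $G=\mathbb{Z}_{r_1}\times\mathbb{Z}_{r_2}\times\cdots\times\mathbb{Z}_{r_n}$ and $V=G_{\varepsilon_1}\oplus G_{\varepsilon_2}\oplus\cdots\oplus G_{\varepsilon_n}$. For $a=(a_1,\dots,a_n)$ and $c=(c_1,\dots,c_n)$ in $G$ and $k\ge0$, the number of walks of $k$ steps from node $a$ to node $c$ on the McKay quiver of $(G,V)$ is $$(A^k)_{a,c}=\sum\binom{k}{\ell_1,\ell_2,\dots,\ell_n},$$ where the sum is over all integers $0\le\ell_1,\ell_2,\dots,\ell_n\le k$ such that $\ell_1+\ell_2+\cdots+\ell_n=k$ and $c_i-a_i\equiv\ell_i\bmod r_i$ for all $i\in\{1,\dots,n\}$.
   Context: $r_1,\dots,r_n$ are positive integers and $\mathbb{Z}_r=\mathbb{Z}/r\mathbb{Z}$. For $a=(a_1,\dots,a_n)\in G$, $G_a$ is the one-dimensional complex $G$-module with character $\chi_a(b)=\omega_1^{a_1b_1}\cdots\omega_n^{a_nb_n}$ for $b=(b_1,\dots,b_n)\in G$, where $\omega_j=e^{2\pi i/r_j}$; these are all the irreducible $G$-modules. $\varepsilon_j\in G$ has $j$th component $1$ and all other components $0$. The McKay quiver of $(G,V)$ is the directed multigraph with node set $G$ whose number of arrows from $a$ to $c$ is the multiplicity of $G_c$ in $G_a\otimes V$; $A$ is its adjacency matrix. $\binom{k}{\ell_1,\dots,\ell_n}=\frac{k!}{\ell_1!\cdots\ell_n!}$. *)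

(* Defs.v *)
From HB Require Import structures.
From mathcomp Require Import all_boot all_order all_algebra all_fingroup all_character.
From mathcomp Require Import boolp reals trigo.
From mathcomp Require Import complex.

Set Implicit Arguments.
Unset Strict Implicit.
Unset Printing Implicit Defensive.

Import Order.TTheory GRing.Theory Num.Theory.

Local Open Scope ring_scope.

Record quiver := Quiver {
  node : finType;
  arrow : finType;
  src : arrow -> node;
  tgt : arrow -> node }.

Definition adjacency (Q : quiver) : 'M[nat]_#|node Q| :=
  \matrix_(x, y) #|[set e : arrow Q | (src e == enum_val x) && (tgt e == enum_val y)]|.

Fixpoint is_walk (Q : quiver) (x y : node Q) (w : seq (arrow Q)) : bool :=
  if w is e :: w' then (src e == x) && is_walk (tgt e) y w' else x == y.

Definition walks (Q : quiver) (k : nat) (x y : node Q) : {set k.-tuple (arrow Q)} :=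
  [set w : k.-tuple (arrow Q) | is_walk x y w].

(* [socle_mult W] is the multiplicity of the simple module [socle_base W] in
   its isotypic component [W]; at most one [W] contributes to the sum, and none
   does when [U] does not occur in [M]. *)
Definition multiplicity (C : decFieldType) (gT : finGroupType) (G : {group gT})
    (U M : representation C G) : nat :=
  (\sum_(W : DecSocleType M | `[< mx_rsim (socle_repr W) U >]) socle_mult W)%N.

(* [U] enumerates the irreducible modules of [G]. *)
Definition mckay_quiver (C : decFieldType) (gT : finGroupType) (G : {group gT})
    (I : finType) (U : I -> representation C G) (V : representation C G) : quiver :=
  @Quiver I
    {p : I * I & 'I_(multiplicity (U p.2) (Representation (prod_repr (U p.1) V)))}
    (fun e => (tag e).1) (fun e => (tag e).2).

(* Z_m for m > 0, including the trivial group for m = 1, which ['Z_1] is not.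
   The group law on [Zprod r] is the componentwise addition. *)
Definition Zprod (n : nat) (r : 'I_n -> nat) : finGroupType :=
  {dffun forall i : 'I_n, 'I_(r i).-1.+1}.

Definition coordinate (n : nat) (r : 'I_n -> nat) (a : Zprod r) (i : 'I_n) : nat :=
  (a : {dffun forall i : 'I_n, 'I_(r i).-1.+1}) i.

Definition epsilon (n : nat) (r : 'I_n -> nat) (j : 'I_n) : Zprod r :=
  [ffun i => inZp (i == j)].

Section Characters.
Variable R : realType.

Definition omega (m : nat) : R[i] :=
  (cos (2 * pi / m%:R) +i* sin (2 * pi / m%:R))%C.

Variables (n : nat) (r : 'I_n -> nat).

Definition chi (a b : Zprod r) : R[i] :=
  \prod_(i < n) omega (r i) ^+ (coordinate a i * coordinate b i).

Lemma omegaX (m k : nat) : omega m ^+ k =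
  (cos (k%:R * (2 * pi / m%:R)) +i* sin (k%:R * (2 * pi / m%:R)))%C.
Proof.
rewrite /omega; move: (2 * pi / m%:R) => t.
elim: k => [|k IHk]; first by rewrite expr0 !mul0r cos0 sin0.
rewrite exprSr IHk -natr1 mulrDl mul1r cosD sinD.
by apply/eqP; rewrite eq_complex /= eqxx addrC eqxx.
Qed.

Lemma omega_unity (m : nat) : omega m ^+ m.-1.+1 = 1.
Proof.
case: m => [|m] /=; first by rewrite expr1 /omega invr0 mulr0 cos0 sin0.
rewrite omegaX mulrCA mulfV ?pnatr_eq0 // mulr1 [2 * pi]mulr_natl.
by rewrite cos2pi sin2pi.
Qed.

Lemma chi_repr (a : Zprod r) :
  mx_repr [set: Zprod r] (fun b => (chi a b)%:M : 'M[R[i]]_1).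
Proof.
split=> [|b c _ _].
  rewrite /chi big1 // => i _; rewrite /coordinate ffunE.
  by rewrite muln0 expr0.
rewrite -scalar_mxM /chi -big_split /=; congr (_%:M).
apply: eq_bigr => i _; rewrite -exprD -mulnDr /coordinate ffunE /=.
by rewrite !exprM expr_mod // exprAC omega_unity expr1n.
Qed.

Definition irrep (a : Zprod r) : representation R[i] [set: Zprod r] :=
  Representation (MxRepresentation (chi_repr a)).

Definition V_rep : representation R[i] [set: Zprod r] :=
  \big[dadd_grepr/grepr0]_(j < n) irrep (epsilon r j).

End Characters.

(* Main.v *)
(* The multiplicity of a linear character x in a module M is the rank of
   sum_g x(g^-1) M(g), which up to the factor |G| is the projector onto the
   x-isotypic component.  This rank is additive in M, and tensoring M with a
   linear module only twists x, so orthogonality of the chi_a gives one arrow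
   from a to a + epsilon_j for each j.  Hence walks of length k are the words in
   {1, ..., n} of length k, whose endpoint depends only on the number l_j of
   occurrences of each letter j; the words with given l are counted by the
   multinomial coefficient. *)
Require Import Defs.
From HB Require Import structures.
From mathcomp Require Import all_boot all_order all_algebra all_fingroup all_character.
From mathcomp Require Import boolp reals trigo.
From mathcomp Require Import complex.
From mathcomp Require Import ring lra.

Set Implicit Arguments.
Unset Strict Implicit.
Unset Printing Implicit Defensive.

Import Order.TTheory GRing.Theory Num.Theory.

Local Open Scope ring_scope.

(** * Multiplicity of a linear character as the rank of a projector *)

Section LinearMultiplicity.
Variables (C : decFieldType) (gT : finGroupType) (G : {group gT}).
Variables (x : gT -> C) (xP : mx_repr G (fun g => (x g)%:M : 'M_1)).
Variables (n : nat) (rG : mx_representation C G n).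
Hypothesis G_neq0 : #|G|%:R != 0 :> C.

Let U := Representation (MxRepresentation xP).

Lemma linear_mulM : {in G &, forall g h, x (g * h)%g = x g * x h}.
Proof.
move=> g h Gg Gh; have := xP.2 g h Gg Gh.
by rewrite -scalar_mxM => /matrixP/(_ ord0 ord0); rewrite !mxE eqxx !mulr1n.
Qed.

Lemma linear_mul1 : x 1%g = 1.
Proof. by have := xP.1 => /matrixP/(_ ord0 ord0); rewrite !mxE eqxx !mulr1n. Qed.

Definition isotypic_mx : 'M_n := \sum_(g in G) x g^-1%g *: rG g.

Definition eigen_rows m (v : 'M_(m, n)) :=
  {in G, forall h, v *m rG h = x h *: v}.

(** Replacing g by g h^-1 in the sum pulls out the factor x(h), since x((g h^-1)^-1) = x(h)
    x(g^-1). *)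
Lemma isotypic_eigen : eigen_rows isotypic_mx.
Proof.
move=> h Gh; rewrite mulmx_suml scaler_sumr (reindex_inj (mulIg h^-1%g)) /=.
apply: eq_big => [g|g Gg]; first by rewrite groupMr ?groupV.
rewrite groupMr ?groupV // in Gg.
rewrite -scalemxAl -repr_mxM ?groupM ?groupV // mulgKV scalerA invMg invgK.
by rewrite linear_mulM ?groupV.
Qed.

(** On eigenrows every term of [isotypic_mx] acts as the identity, hence the sum acts as the
    invertible scalar |G|; this gives the forward direction. *)
Lemma eigen_sub m (v : 'M_(m, n)) : eigen_rows v <-> (v <= isotypic_mx)%MS.
Proof.
split=> [v_eig|/submxP[D ->] h Gh]; last first.
  by rewrite -mulmxA isotypic_eigen // scalemxAr.
have -> : v = (#|G|%:R^-1 *: v) *m isotypic_mx; last exact: submxMl.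
rewrite -scalemxAl mulmx_sumr (eq_bigr (fun _ => v)) => [|g Gg].
  by rewrite sumr_const -scaler_nat scalerA mulVf // scale1r.
rewrite -scalemxAr v_eig // scalerA -linear_mulM ?groupV //.
by rewrite mulVg linear_mul1 scale1r.
Qed.

Lemma eigen_module (N : 'M_n) : eigen_rows N -> mxmodule rG N.
Proof. by move=> eigN; apply/mxmoduleP=> h Gh; rewrite eigN // scalemx_sub. Qed.

(** [U] is one-dimensional and acts by scalars, which commute with any intertwiner. A row-free
    intertwiner can thus be cancelled, which forces the same scalar action on [N]. *)
Lemma eigen_rsim (N : 'M_n) (modN : mxmodule rG N) :
  mx_rsim (submod_repr modN) U <-> \rank N = 1%N /\ eigen_rows N.
Proof.
split=> [[B rN fB simB]|[rN eigN]].
  split=> // h Gh; have rUh : submod_repr modN h = (x h)%:M.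
    by apply: (row_free_inj fB); rewrite simB //= mul_mx_scalar mul_scalar_mx.
  rewrite -{1}(in_submodK (submx_refl N)) -(val_submodJ modN) //.
  by rewrite rUh mul_mx_scalar linearZ /= in_submodK.
(* Conversely, both modules are lines with the same scalar action, so the identity, cast along [rN],
   is an isomorphism. *)
apply: (MxReprSim (B := castmx (erefl, rN) 1%:M)) => // [|h Gh].
  by move: (\rank N) rN => r rN; case: _ / rN; rewrite row_free_unit unitmx1.
have /eigen_sub sv : eigen_rows (val_submod 1%:M : 'M_(\rank N, n)).
  by apply/eigen_sub/(submx_trans (val_submodP _))/eigen_sub.
rewrite /= /submod_mx.
move/eigen_sub: sv => -> //.
by rewrite linearZ /= val_submodK -scalemxAl mul1mx mul_mx_scalar.
Qed.

Lemma eigen_simple (N : 'M_n) : \rank N = 1%N -> eigen_rows N -> mxsimple rG N.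
Proof.
move=> rN eigN; split; [exact: eigen_module|by rewrite -mxrank_eq0 rN|].
move=> W _ sWN nzW; have := mxrank_leqif_sup sWN => -[].
by rewrite rN => W1 <-; rewrite eqn_leq W1 lt0n mxrank_eq0.
Qed.

Lemma eigen_row_simple (v : 'rV_n) : v != 0 -> eigen_rows v ->
  \rank <<v>>%MS = 1%N /\ eigen_rows <<v>>%MS.
Proof.
move=> nzv /eigen_sub sv; split; last by apply/eigen_sub; rewrite genmxE.
by apply/eqP; rewrite genmxE eqn_leq rank_leq_row lt0n mxrank_eq0.
Qed.

(** The component [W] and the row space of [isotypic_mx] coincide. The first is a sum of copies of
    [U], all made of eigenrows; each nonzero row of the second spans a copy of [U]. Since the simple
    module has rank 1, the multiplicity is the rank of the component itself. *)
Lemma socle_rank (sG : socleType rG) (W : sG) :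
  mx_rsim (socle_repr W) U -> socle_mult W = \rank isotypic_mx.
Proof.
move=> simW; have [rW eigW] := (eigen_rsim (socle_module W)).1 simW.
rewrite /socle_mult rW divn1; apply/eqmx_rank/andP; split.
  rewrite /socle_val; have [I [N isoN ->]] := component_mx_def (socle_simple W).
  apply/sumsmx_subP=> i _; apply/eigen_sub.
  have modN : mxmodule rG (N i).
    exact: mxsimple_module (mx_iso_simple (isoN i) (socle_simple W)).
  apply: (proj2 ((eigen_rsim modN).1 _)); apply: mx_rsim_trans simW.
  by apply/mx_rsim_iso/mx_iso_sym.
apply/row_subP=> i; have [->|nz_i] := eqVneq (row i isotypic_mx) 0.
  exact: sub0mx.
have [//|r1 eig1] := eigen_row_simple nz_i; first by apply/eigen_sub/row_sub.
rewrite -(genmxE (row _ _)); apply: (mx_iso_component (socle_simple W)).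
apply/(mx_rsim_iso (socle_module W) (eigen_module eig1)).
apply: mx_rsim_trans simW _; apply: mx_rsim_sym.
exact/eigen_rsim.
Qed.

End LinearMultiplicity.

Lemma multiplicity_linear (C : decFieldType) (gT : finGroupType)
    (G : {group gT}) (x : gT -> C) (xP : mx_repr G (fun g => (x g)%:M : 'M_1))
    (M : representation C G) :
  #|G|%:R != 0 :> C ->
  multiplicity (Representation (MxRepresentation xP)) M =
    \rank (isotypic_mx x M).
Proof.
move=> G_neq0; set U := Representation _; rewrite /multiplicity.
have [|noW] := pselect (exists W : DecSocleType M, mx_rsim (socle_repr W) U).
  case=> W simW; rewrite (bigD1 W) /=; last exact/asboolP.
  rewrite (socle_rank G_neq0 simW) // big1 ?addn0 // => W' /andP[/asboolP simW'].
  case/negP; apply/socle_rsimP; exact: mx_rsim_trans simW' (mx_rsim_sym simW).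
rewrite big1 => [|W /asboolP simW]; last by case: noW; exists W.
(* A nonzero [v] in the row space would span a copy of [U], and the socle would have a component for
   it. *)
apply/esym/eqP; rewrite mxrank_eq0; apply/rowV0P => v sv.
apply: contrapT => /eqP nzv; apply: noW.
have [r1 eig1] := eigen_row_simple xP G_neq0 nzv ((eigen_sub xP M G_neq0 v).2 sv).
have [W isoW] := Socle_iso (DecSocleType M) (eigen_simple r1 eig1).
exists W; apply: mx_rsim_trans (_ : mx_rsim (submod_repr (eigen_module eig1)) U).
  exact/mx_rsim_iso.
exact/eigen_rsim.
Qed.

(** * Behaviour of the rank under direct sums and tensoring with a line *)

Section IsotypicRank.
Variables (C : decFieldType) (gT : finGroupType) (G : {group gT}).
Implicit Types (x : gT -> C) (M : representation C G).

Lemma isotypic_rank0 x :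
  \rank (isotypic_mx x (grepr0 : representation C G)) = 0%N.
Proof. by apply/eqP; rewrite -leqn0 rank_leq_row. Qed.

Lemma isotypic_rankD x M1 M2 :
  \rank (isotypic_mx x (dadd_grepr M1 M2)) =
    (\rank (isotypic_mx x M1) + \rank (isotypic_mx x M2))%N.
Proof.
rewrite -rank_diag_block_mx; congr (\rank _).
apply: (big_rec3 (fun A B D => D = block_mx A 0 0 B)) => [|g A B D Gg ->].
  by rewrite block_mx0.
by rewrite scale_block_mx !scaler0 add_block_mx !addr0.
Qed.

(** The tensor product acts by y(g) M(g), up to the cast between 1 * n and n. The inverse in the
    twisted character appears because [isotypic_mx] evaluates its argument at g^-1. *)
Lemma isotypic_rank_prod x (y : gT -> C)
    (yP : mx_repr G (fun g => (y g)%:M : 'M_1)) M :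
  \rank (isotypic_mx x (prod_repr (MxRepresentation yP) M)) =
  \rank (isotypic_mx (fun g => x g * y (g^-1)%g) M).
Proof.
have -> : isotypic_mx x (prod_repr (MxRepresentation yP) M) =
   castmx (esym (mul1n _), esym (mul1n _))
     (isotypic_mx (fun g => x g * y (g^-1)%g) M).
  rewrite /isotypic_mx.
  have cast_sum n m (e : n = m) (A : gT -> 'M[C]_n) :
      castmx (e, e) (\sum_(g in G) A g) = \sum_(g in G) castmx (e, e) (A g).
    by case: m / e.
  have castZ n m (e : n = m) a (A : 'M[C]_n) :
      castmx (e, e) (a *: A) = a *: castmx (e, e) A.
    by case: m / e.
  rewrite cast_sum; apply: eq_bigr => g Gg.
  by rewrite prod_repr_lin //= mxE mulr1n -scalerA !castZ invgK.
by move: (esym (mul1n _)) => e; case: _ / e.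
Qed.

End IsotypicRank.

(** * Orthogonality of the characters and the arrows of the McKay quiver *)

Section CharacterSums.
Variables (R : realType) (n : nat) (r : 'I_n -> nat).
Implicit Types a b c d : Zprod r.

Lemma omegaX_neq1 (m k : nat) : (0 < k < m)%N -> omega R m ^+ k != 1.
Proof.
move=> /andP[k0 km]; rewrite omegaX; apply/negP => /eqP[cos1 _].
have m0 : (0 < m%:R :> R) by rewrite ltr0n (leq_trans _ km).
(* [s] is half the angle and lies strictly between 0 and pi, so cos(2s) = 1 - 2 sin(s)^2 < 1. *)
pose s : R := k%:R * (pi / m%:R).
have : 0 < sin s.
  apply: sin_gt0_pi; rewrite /s mulr_gt0 ?divr_gt0 ?pi_gt0 //= ?ltr0n //.
  by rewrite mulrCA gtr_pMr ?pi_gt0 // ltr_pdivrMr // mul1r ltr_nat.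
move: cos1; have -> : k%:R * (2 * pi / m%:R) = s *+ 2.
  by rewrite /s; ring.
rewrite cos_mulr2n cos2sin2 => cos1 /(exprn_gt0 2).
by lra.
Qed.

Lemma coordinateM a b i :
  coordinate (a * b)%g i = ((coordinate a i + coordinate b i) %% (r i).-1.+1)%N.
Proof. by rewrite /coordinate ffunE. Qed.

Lemma chi_sym a b : chi R a b = chi R b a.
Proof. by apply: eq_bigr => i _; rewrite mulnC. Qed.

Lemma chiMr a b c : chi R a (b * c)%g = chi R a b * chi R a c.
Proof. by rewrite (linear_mulM (chi_repr R a)) ?inE. Qed.

Lemma chi1r a : chi R a 1%g = 1.
Proof. exact: linear_mul1 (chi_repr R a). Qed.

Lemma chiMl a b c : chi R (a * b)%g c = chi R a c * chi R b c.
Proof. by rewrite chi_sym chiMr !(chi_sym c). Qed.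

Lemma chiV a b : chi R a b^-1%g = chi R a^-1%g b.
Proof.
have nz : chi R a b != 0.
  apply/eqP => z; have := chiMr a b b^-1%g.
  by rewrite z mul0r mulgV chi1r => /eqP; rewrite oner_eq0.
apply: (mulfI nz); rewrite -chiMr -chiMl !mulgV chi1r.
by rewrite chi_sym chi1r.
Qed.

Lemma chi_epsilon a j : chi R a (epsilon r j) = omega R (r j) ^+ coordinate a j.
Proof.
rewrite /chi (bigD1 j) //= big1 ?mulr1 => [|i ij].
  rewrite /coordinate /epsilon ffunE eqxx /=.
  (* For [r j] equal to 0 or 1 the factor is trivial: [epsilon] has coordinate 0 there, but so has
     [a], and both exponents vanish. *)
  case: (r j) (_ a j) => [|[|m]] x /=.
  - by rewrite modn1 muln0 ord1.
  - by rewrite modn1 muln0 ord1.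
  - by rewrite modn_small ?muln1.
by rewrite /coordinate /epsilon ffunE (negPf ij) /= mod0n muln0.
Qed.

(** If [d] has a nonzero coordinate i, translating the summation variable by [epsilon r i]
    multiplies the sum by a factor different from 1, so the sum vanishes. *)
Lemma chi_sum d :
  \sum_(g : Zprod r) chi R d g = if d == 1%g then #|Zprod r|%:R else 0.
Proof.
have [->|d1] := eqVneq.
  rewrite -sumr_const; apply: eq_big => // g _.
  by rewrite chi_sym chi1r.
have [i di] : exists i, coordinate d i != 0%N.
  apply/existsP; apply: contraNT d1; rewrite negb_exists => /forallP d0.
  apply/eqP/ffunP => i; apply/val_inj; rewrite !ffunE /=.
  by have := d0 i; rewrite negbK => /eqP.
have : chi R d (epsilon r i) != 1.
  rewrite chi_epsilon omegaX_neq1 // lt0n di /=.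
  have : (coordinate d i < (r i).-1.+1)%N := ltn_ord _.
  by move: di; move: (coordinate d i) (r i) => [|k] [|m].
apply: contraNeq => s0; apply/eqP/(mulIf s0); rewrite mul1r mulr_sumr.
rewrite [RHS](reindex_inj (mulgI (epsilon r i))) /=.
by apply: eq_bigr => g _; rewrite chiMr.
Qed.

Lemma card_Zprod_neq0 : #|[set: Zprod r]|%:R != 0 :> R[i].
Proof. by rewrite pnatr_eq0 -lt0n cardG_gt0. Qed.

Lemma multiplicity_mckay a c :
  multiplicity (irrep R c) (Representation (prod_repr (irrep R a) (V_rep R r))) =
    (\sum_(j < n) ((a * epsilon r j)%g == c))%N.
Proof.
rewrite multiplicity_linear ?card_Zprod_neq0 // isotypic_rank_prod.
rewrite /V_rep (big_morph _ (isotypic_rankD _) (isotypic_rank0 _ _)).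
apply: eq_bigr => j _; rewrite /isotypic_mx /=.
(* The three factors merge into the single character of c^-1 a epsilon_j, whose sum over the group
   is |G| or 0; the resulting 1 by 1 matrix has rank 1 or 0. *)
under eq_bigr => g _.
  rewrite scale_scalar_mx invgK !chiV -!chiMl; over.
rewrite -raddf_sum /=.
rewrite (eq_bigl predT) => [|g]; last by rewrite inE.
rewrite chi_sum -mulgA -eq_invg_mul invgK eq_sym.
case: eqP => _; last by rewrite raddf0 mxrank0.
by rewrite -scalemx1 mxrank_scale_nz ?mxrank1 // -cardsT card_Zprod_neq0.
Qed.

End CharacterSums.

(** * Walks on a quiver and powers of its adjacency matrix *)

Lemma sum_tuple_cons (T : finType) (k : nat) (F : seq T -> nat) :
  (\sum_(w : k.+1.-tuple T) F w =
     \sum_(t : T) \sum_(w : k.-tuple T) F (t :: w))%N.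
Proof.
rewrite pair_big /= (reindex (fun p : T * k.-tuple T => [tuple of p.1 :: p.2])) //=.
exists (fun w => (thead w, [tuple of behead w])) => [[t w] _|w _] /=.
  by congr (_, _); apply: val_inj.
by rewrite -tuple_eta.
Qed.

Lemma sum_tuple0 (T : finType) (F : seq T -> nat) :
  (\sum_(w : 0.-tuple T) F w = F [::])%N.
Proof.
rewrite (eq_bigr (fun _ => F [::])) => [|w _]; last by rewrite tuple0.
by rewrite sum_nat_const card_tuple mul1n.
Qed.

Section QuiverWalks.
Variable Q : quiver.

(** Grouping the arrows out of [x] by target recovers the row of [x] in the adjacency matrix. This
    matches the recursion of [is_walk] on the first arrow. *)
Lemma adjacencyXS (k : nat) (x y : node Q) :
  (adjacency Q ^+ k.+1) (enum_rank x) (enum_rank y) =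
    (\sum_(e : arrow Q | src e == x)
       (adjacency Q ^+ k) (enum_rank (tgt e)) (enum_rank y))%N.
Proof.
rewrite exprS mxE (reindex enum_rank); last exact/onW_bij/enum_rank_bij.
rewrite (partition_big (@tgt Q) predT) //=; apply: eq_bigr => z _.
rewrite mxE !enum_rankK.
rewrite (eq_bigr (fun _ => (adjacency Q ^+ k) (enum_rank z) (enum_rank y))).
  by rewrite sum_nat_const cardsE.
by move=> e /andP[_ /eqP ->].
Qed.

Lemma card_walks (k : nat) (x y : node Q) :
  #|walks k x y| = (adjacency Q ^+ k) (enum_rank x) (enum_rank y).
Proof.
rewrite cardsE -sum1_card big_mkcond /=.
elim: k x => [|k IHk] x.
  rewrite (sum_tuple0 (fun w => if is_walk x y w then 1%N else 0%N)) /= expr0 mxE.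
  by rewrite (inj_eq enum_rank_inj); case: eqP.
rewrite (sum_tuple_cons _ (fun w => if is_walk x y w then 1%N else 0%N)).
rewrite adjacencyXS [RHS]big_mkcond; apply: eq_bigr => e _ /=.
by case: eqP => [_|_] /=; [rewrite -IHk | rewrite big1].
Qed.

End QuiverWalks.

(** * Words with prescribed letter counts *)

Section ContentCount.
Variable T : finType.

(** The multinomial count, in a form without division. Induction on the first letter t: its words
    contribute l_t k!, and these contributions add up to (k+1)!. *)
Lemma card_content (k : nat) (l : T -> nat) : (\sum_t l t)%N = k ->
  (#|[set w : k.-tuple T | [forall t, count_mem t w == l t]]| *
     \prod_t (l t)`! = k`!)%N.
Proof.
pose F (l : T -> nat) (w : seq T) :=
  if [forall t, count_mem t w == l t] then 1%N else 0%N.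
have -> : #|[set w : k.-tuple T | [forall t, count_mem t w == l t]]| =
    (\sum_(w : k.-tuple T) F l w)%N.
  by rewrite -sum1_card big_mkcond; apply: eq_bigr => w _; rewrite inE.
elim: k l => [|k IHk] l suml.
  have l0 t : l t = 0%N.
    by apply/eqP; move/eqP: suml; rewrite sum_nat_eq0 => /forallP/(_ t).
  rewrite (sum_tuple0 (F l)) /F.
  have -> : [forall t, count_mem t [::] == l t] by apply/forallP => t; rewrite l0.
  by rewrite big1 // => t _; rewrite l0.
rewrite (sum_tuple_cons _ (F l)) big_distrl /= factS -[in RHS]suml big_distrl /=.
apply: eq_bigr => t _; have [lt0|lt_gt0] := posnP (l t).
  rewrite lt0 mul0n big1 ?mul0n // => w _; rewrite /F.
  by case: forallP => // /(_ t); rewrite /= eqxx lt0.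
(* [l'] is the content of the word left after removing the initial [t]; the subtraction does not
   truncate because [l t] is positive. *)
pose l' u := (l u - (u == t))%N.
rewrite (eq_bigr (fun w : k.-tuple T => F l' w)) => [|w _]; last first.
  congr (if _ then _ else _); apply: eq_forallb => u; rewrite /l' /= [t == u]eq_sym.
  have [->|_] := eqVneq u t; last by rewrite subn0.
  by rewrite -{1}(subnK lt_gt0) addnC eqn_add2r.
have -> : (\prod_u (l u)`! = l t * \prod_u (l' u)`!)%N.
  rewrite (bigD1 t) // [in RHS](bigD1 t) //= /l' eqxx mulnA; congr (_ * _)%N.
    by rewrite -{1 2}(subnK lt_gt0) addn1 factS.
  by apply: eq_bigr => u /negPf->; rewrite subn0.
rewrite mulnCA IHk // /l' sumnB => [|u _]; last by case: eqP => [->|].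
rewrite suml (bigD1 t) //= eqxx big1 ?addn0 ?subn1 // => u /negPf-> //.
Qed.

End ContentCount.

(** * Walks on the McKay quiver as words *)

Lemma adjacency_mckay (C : decFieldType) (gT : finGroupType) (G : {group gT})
    (I : finType) (U : I -> representation C G) (V : representation C G) (a c : I) :
  adjacency (mckay_quiver U V) (enum_rank a) (enum_rank c) =
    multiplicity (U c) (Representation (prod_repr (U a) V)).
Proof.
rewrite mxE !enum_rankK -[RHS]card_ord -cardsT.
pose T (p : I * I) := 'I_(multiplicity (U p.2) (Representation (prod_repr (U p.1) V))).
have inj_tag : injective (fun t : T (a, c) => Tagged T t).
  by move=> t u /eqP; rewrite eq_Tagged => /eqP.
rewrite -(card_imset _ inj_tag).
apply: eq_card => -[[x y] t]; rewrite !inE /=.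
apply/andP/imsetP => [[/eqP xa /eqP yc]|[u _]]; last first.
  by move/(congr1 tag) => [-> ->].
by move: t; rewrite xa yc => t; exists t.
Qed.

Section Words.
Variables (R : realType) (n : nat) (r : 'I_n -> nat).
Let A := adjacency (mckay_quiver (@irrep R n r) (V_rep R r)).

Lemma mckayX (k : nat) (a c : Zprod r) :
  (A ^+ k) (enum_rank a) (enum_rank c) =
    (\sum_(w : k.-tuple 'I_n) ((a * \prod_(j <- w) epsilon r j)%g == c))%N.
Proof.
elim: k a => [|k IHk] a.
  rewrite (sum_tuple0 (fun w => ((a * \prod_(j <- w) epsilon r j)%g == c) : nat)).
  by rewrite big_nil mulg1 expr0 mxE (inj_eq enum_rank_inj); case: eqP.
rewrite (sum_tuple_cons _ (fun w => ((a * \prod_(j <- w) epsilon r j)%g == c) : nat)).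
rewrite exprS mxE (reindex enum_rank); last exact/onW_bij/enum_rank_bij.
transitivity (\sum_(b : Zprod r) \sum_(j < n)
    ((a * epsilon r j)%g == b) * (A ^+ k) (enum_rank b) (enum_rank c))%N.
  apply: eq_bigr => b _; rewrite -big_distrl /=; congr (_ * _)%N.
  by rewrite /A adjacency_mckay multiplicity_mckay.
rewrite exchange_big; apply: eq_bigr => j _ /=.
(* For a fixed first letter [j], only the intermediate node a epsilon_j contributes. *)
rewrite (bigD1 (a * epsilon r j)%g) //= eqxx mul1n big1 ?addn0 => [|b nb]; last first.
  by rewrite eq_sym (negPf nb).
by rewrite IHk; apply: eq_bigr => w _; rewrite big_cons mulgA.
Qed.

Lemma coordinate_word (a : Zprod r) (w : seq 'I_n) (i : 'I_n) :
  coordinate (a * \prod_(j <- w) epsilon r j)%g i =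
    ((coordinate a i + count_mem i w) %% (r i).-1.+1)%N.
Proof.
elim: w a => [|j w IHw] a.
  by rewrite big_nil mulg1 addn0 modn_small // ltn_ord.
rewrite big_cons mulgA IHw coordinateM modnDml /= addnA.
rewrite {2}/coordinate /epsilon ffunE /= [i == j]eq_sym.
by rewrite -[LHS]modnDml modnDmr modnDml.
Qed.

End Words.

Lemma sum_count_mem (T : finType) (s : seq T) : (\sum_t count_mem t s)%N = size s.
Proof.
elim: s => [|x s IHs] /=; first exact: big1.
rewrite big_split /= IHs (bigD1 x) //= eqxx big1 // => t tx.
by rewrite eq_sym (negPf tx).
Qed.

Theorem corollary6p6 (R : realType) (n : nat) (r : 'I_n -> nat)
    (r_gt0 : forall i, (0 < r i)%N) (a c : Zprod r) (k : nat) :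
  let Q := mckay_quiver (@irrep R n r) (@V_rep R n r) in
  let A := adjacency Q in
  let number_of_walks := #|@walks Q k a c| in
  number_of_walks = (A ^+ k) (enum_rank a) (enum_rank c) /\
  (A ^+ k) (enum_rank a) (enum_rank c) =
    (\sum_(l : {ffun 'I_n -> 'I_k.+1} |
         ((\sum_(i < n) l i)%N == k) &&
         [forall i : 'I_n,
            ((coordinate c i)%:Z - (coordinate a i)%:Z == (l i)%:Z %[mod (r i)%:Z])%Z])
       k`! %/ \prod_(i < n) (l i)`!)%N.
Proof.
split; first exact: card_walks.
rewrite mckayX.
(* A letter occurs at most [k] times in a word of length [k], so [inord] loses nothing. *)
pose content (w : k.-tuple 'I_n) : {ffun 'I_n -> 'I_k.+1} :=
  [ffun i => inord (count_mem i w)].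
have contentE w i : content w i = count_mem i w :> nat.
  by rewrite ffunE inordK // ltnS -{2}(size_tuple w) count_size.
have sum_content (w : k.-tuple 'I_n) : (\sum_(i < n) count_mem i w)%N = k.
  by rewrite sum_count_mem size_tuple.
pose P (l : 'I_n -> nat) := [forall i : 'I_n,
  ((coordinate c i)%:Z - (coordinate a i)%:Z == (l i)%:Z %[mod (r i)%:Z])%Z].
have word_end w : ((a * \prod_(j <- w) epsilon r j)%g == c) = P (fun i => count_mem i w).
  have modP i :
    ((coordinate c i)%:Z - (coordinate a i)%:Z == (count_mem i w)%:Z %[mod (r i)%:Z])%Z
      = (coordinate (a * \prod_(j <- w) epsilon r j)%g i == coordinate c i).
    (* Adding a_i to both sides moves the congruence from integers to naturals; c_i is already
       reduced modulo r_i. *)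
    rewrite -(eqz_modDr (coordinate a i)%:Z) subrK -PoszD !modz_nat eqz_nat.
    rewrite coordinate_word prednK // addnC eq_sym [X in _ == X]modn_small //.
    by rewrite -(prednK (r_gt0 i)) ltn_ord.
  apply/eqP/forallP => [wc i|end_w]; first by apply: etrans (modP i) _; rewrite wc eqxx.
  by apply/ffunP => i; apply/val_inj/eqP; rewrite -[_ == _]modP; apply: end_w.
under eq_bigr => w _ do rewrite word_end.
rewrite -big_mkcond.
rewrite (partition_big content (fun l : {ffun 'I_n -> 'I_k.+1} =>
  ((\sum_(i < n) l i)%N == k) && P (fun i => l i))) /=; last first.
  move=> w Pw; rewrite (eq_bigr (fun i => count_mem i w)) ?sum_content ?eqxx //=.
  by apply: etrans Pw; apply: eq_forallb => i; rewrite contentE.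
apply: eq_bigr => l /andP[/eqP suml Pl].
have prod_fact_gt0 : (0 < \prod_(i < n) (l i)`!)%N.
  by rewrite prodn_gt0 // => i; rewrite fact_gt0.
(* The quotient is exact: k! is the number of words of content [l] times the product of
   factorials. *)
rewrite -(card_content (l := fun i => l i : nat) suml) mulnK // -sum1_card.
apply: eq_bigl => w; rewrite inE.
have -> : (content w == l) = [forall i, count_mem i w == l i].
  apply/eqP/forallP => [<- i|eqw]; first by rewrite contentE.
  by apply/ffunP => i; apply/val_inj; rewrite /= contentE; apply/eqP.
(* The end of a word depends only on its content, so every word of content [l] inherits the
   congruences from [Pl]. *)
apply: andb_idl => /forallP eqw; apply: etrans Pl.
by apply: eq_forallb => i; rewrite (eqP (eqw i)).
Qed.
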